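(* Let $m,n,d\ge1$ with $\gcd(m,n)=1$ and let $0\le l\le d-1$. Every equivalence class of $0$-normalized $(nd,md)$-invariant subsets of $\mathbb{Z}_{\ge 0}$ having nontrivial intersection with exactly $l+1$ congruence classes modulo $d$ contains a unique admissible representative.
   Context: A subset $\Delta\subset\mathbb{Z}_{\ge0}$ is $(p,q)$-invariant if $\Delta+p\subset\Delta$ and $\Delta+q\subset\Delta$; it is $0$-normalized if $0\in\Delta$. For an $(n,m)$-invariant subset $\Theta$ its skeleton is the union of the set of $n$-generators ($a\in\Theta$, $a-n\notin\Theta$) and the set of $m$-cogenerators ($b\in\mathbb{Z}\setminus\Theta$, $b+m\in\Theta$). Equivalence: let $\Theta=\{\Theta_0^0,\dots,\Theta_l^0\}$ be a collection of $0$-normalized $(n,m)$-invariant subsets with skeletons $S_0^0,\dots,S_l^0$. For $(x_1,\dots,x_l)\in\mathbb{R}_{\ge0}^l$, with $x_0=0$, put $\Delta(x_1,\dots,x_l)=\bigcup_{k=0}^l(d\Theta_k^0+x_k)$. If $x_0,\dots,x_l$ are integers with pairwise different remainders mod $d$, this is a $0$-normalized $(nd,md)$-invariant subset meeting exactly $l+1$ classes mod $d$; every such subset arises this way. Let $\Sigma_\Theta\subset\mathbb{R}^l_{\ge0}$ be the set of $(x_1,\dots,x_l)$ for which there exist $i\neq j$ in $\{0,\dots,l\}$ with $(dS_i^0+x_i)\cap(dS_j^0+x_j)\ne\emptyset$ (a hyperplane arrangement). Two $(nd,md)$-invariant subsets are equivalent if they can be written as $\Delta(x_1,\dots,x_l)$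 and $\Delta(y_1,\dots,y_l)$ for the same collection $\Theta$ with $(x_1,\dots,x_l)$ and $(y_1,\dots,y_l)$ in the same connected component of $\mathbb{R}^l_{\ge0}\setminus\Sigma_\Theta$. (Hence components differing by exchanging coordinates $x_i,x_j$ with $\Theta_i^0=\Theta_j^0$ give the same class.) Admissible: a $0$-normalized $(nd,md)$-invariant subset $\Delta$ is called admissible if $\Delta\cap(d\mathbb{Z}+r)\neq\emptyset$ for $r\in\{0,\dots,l\}$, $\Delta\cap(d\mathbb{Z}+r)=\emptyset$ for $r\in\{l+1,\dots,d-1\}$, and for every $k\in\{0,\dots,l-1\}$ $$\Delta\cap(d\mathbb{Z}+k+1)\not\subseteq\big(\Delta\cap(d\mathbb{Z}+k)\big)+dn+dm+1.$$ (For $l=d-1$, i.e. $\Delta$ cofinite, this is equivalent to: for each residue $j$ mod $d$ there is an $(nd)$-generator $a\equiv j$ mod $d$ of $\Delta$ with $a+md+1\in\Delta$.) *)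

(* Defs.v *)
From HB Require Import structures.
From mathcomp Require Import all_boot all_order all_algebra.
From mathcomp Require Import all_classical all_reals all_analysis.

Set Implicit Arguments.
Unset Strict Implicit.
Unset Printing Implicit Defensive.

Import Order.TTheory GRing.Theory Num.Theory.
Import numFieldNormedType.Exports.

Local Open Scope classical_set_scope.
Local Open Scope ring_scope.

(* Subsets of Z_{>=0} are sets of integers contained in [0, +oo[: generators and
   cogenerators refer to membership of possibly negative integers. *)
Definition invariant_subset (p q : nat) (D : set int) : Prop :=
  [/\ forall a, D a -> 0 <= a,
      forall a, D a -> D (a + p%:Z)
    & forall a, D a -> D (a + q%:Z)].

Definition zero_normalized (D : set int) : Prop := D 0.

Definition generators (p : nat) (D : set int) : set int :=
  [set a | D a /\ ~ D (a - p%:Z)].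

Definition cogenerators (q : nat) (D : set int) : set int :=
  [set b | ~ D b /\ D (b + q%:Z)].

Definition skeleton (n m : nat) (T : set int) : set int :=
  generators n T `|` cogenerators m T.

Definition residue_class (d r : nat) : set int :=
  [set z : int | (z = r%:Z %[mod d%:Z])%Z].

Definition num_residues (d : nat) (D : set int) : nat :=
  #|[pred r : 'I_d | `[< D `&` residue_class d r !=set0 >] ]|.

Definition normalized_subsets (m n d l : nat) : set (set int) :=
  [set D | [/\ invariant_subset (n * d) (m * d) D,
               zero_normalized D
             & num_residues d D = l.+1] ].

Section Arrangement.
Context {R : realType}.

(* (x_1, ..., x_l) extended by x_0 = 0. *)
Definition coord0 (l : nat) (x : 'rV[R]_l) (k : 'I_l.+1) : R :=
  if unlift ord0 k is Some i then x ord0 i else 0.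

Definition dilate_shift (d : nat) (S : set int) (x : R) : set R :=
  [set d%:R * s%:~R + x | s in S].

Definition Delta (d l : nat) (Theta : 'I_l.+1 -> set int) (x : 'rV[R]_l) :
    set R :=
  \bigcup_(k in [set: 'I_l.+1]) dilate_shift d (Theta k) (coord0 x k).

Definition orthant (l : nat) : set 'rV[R]_l :=
  [set x | forall i, 0 <= x ord0 i].

Definition Sigma (m n d l : nat) (Theta : 'I_l.+1 -> set int) :
    set 'rV[R]_l :=
  [set x | orthant x /\
    exists i j : 'I_l.+1, i != j /\
      dilate_shift d (skeleton n m (Theta i)) (coord0 x i)
        `&` dilate_shift d (skeleton n m (Theta j)) (coord0 x j) !=set0].

(* D = Delta(x_1, ..., x_l), where x_0, ..., x_l are integers with pairwise
   different remainders mod d. *)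
Definition written_as (d l : nat) (D : set int) (Theta : 'I_l.+1 -> set int)
    (x : 'rV[R]_l) : Prop :=
  [/\ orthant x,
      exists a : 'I_l.+1 -> int,
        (forall k, coord0 x k = (a k)%:~R) /\
        (forall i j, (a i = a j %[mod d%:Z])%Z -> i = j)
    & [set z%:~R | z in D] = Delta d Theta x].

End Arrangement.

Definition equivalent (R : realType) (m n d l : nat) (D E : set int) : Prop :=
  exists Theta : 'I_l.+1 -> set int,
    (forall k, invariant_subset n m (Theta k) /\ zero_normalized (Theta k)) /\
    exists x y : 'rV[R]_l,
      [/\ written_as d D Theta x,
          written_as d E Theta y
        & connected_component (@orthant R l `\` Sigma m n d Theta) x y].

Definition equivalence_class (R : realType) (m n d l : nat)
    (C : set (set int)) : Prop :=
  exists2 D, normalized_subsets m n d l D &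
    C = [set E | normalized_subsets m n d l E /\ equivalent R m n d l D E].

Definition admissible (m n d l : nat) (D : set int) : Prop :=
  [/\ invariant_subset (n * d) (m * d) D /\ zero_normalized D,
      forall r, (r <= l)%N -> D `&` residue_class d r !=set0,
      forall r, (l < r < d)%N -> D `&` residue_class d r = set0
    & forall k, (k < l)%N ->
        ~ (D `&` residue_class d k.+1 `<=`
             [set a + (d * n)%:Z + (d * m)%:Z + 1
                | a in D `&` residue_class d k])].

(* Main.v *)
Require Import Defs.
From HB Require Import structures.
From mathcomp Require Import all_boot all_order all_algebra.
From mathcomp Require Import all_classical all_reals all_analysis.
From mathcomp Require Import perm zify ring lra.

(** The component of a point only remembers in which order the dilated skeletons
lie on the line.  Two integer configurations [a] and [b], with pairwise distinct
residues mod [d], lie in the same component exactly when all the comparisons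
[d s + a i < d t + a j] between skeleton points have the same outcome for [b]
([component_same_order]): a segment joining two points with the same outcomes
meets no wall, and conversely a difference of two skeleton points is continuous
and never vanishes off the arrangement.  Everything else is combinatorics of
integer configurations.

Write [a i = d * level + rem] and let [contracted a i] be the [i]-th residue
class of the subset, divided by [d]; it is an (n, m)-invariant set [E i].  Say
that [E precedes E'] when [E'] is contained in [E + n + m], so that
admissibility forbids that a class precedes the class of the next residue.
The skeleton of [E] is [(E - m) \ (E + n)], that is, the set of smallest
elements of [E - m] in the classes mod [n + m].  As [n] generates the integers
mod [n + m], comparing these smallest elements along the orbit of [n] gives the
key dichotomy ([common_skeleton_or_precedes]): two invariant sets either share a
skeleton point (they are linked) or one of them precedes the other, and
never both.  Exchanging adjacent residues of two unlinked classes crosses no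
wall, while the order of the residues of linked classes is an invariant of the
component.  The situation is that of normal forms in a trace monoid whose
commutation relation is comparability in a partial order.

Existence: among the integer configurations of the component take one that
minimises the sum of squares of the coordinates.  A missing residue below a
residue in use allows to decrease a coordinate by one; a class that precedes
the class of the next residue has a much smaller coordinate, and exchanging the
two residues (and translating back to [a 0 = 0]) lowers the sum of squares.
Hence a minimum is admissible ([energy_descent]).

Uniqueness: suppose that [E e] precedes [E f], that [e] comes before [f] in the
order of residues, and that no class strictly in between is linked to [f].
Each class in between precedes [E f] or is preceded by it; at the last one
that precedes [E f], transitivity contradicts admissibility
([no_unlinked_chain]).  Starting from the class of 0, it follows that every
class is linked to one of smaller residue, which bounds its level from below by
the level in any other configuration of the component; by symmetry two
admissible configurations have the same levels.  If their residues differed, the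
first place of difference would give two unlinked classes in opposite orders,
and the same chain argument excludes this ([admissible_config_unique]). *)

Set Implicit Arguments.
Unset Strict Implicit.
Unset Printing Implicit Defensive.

Import Order.TTheory GRing.Theory Num.Theory.
Import numFieldNormedType.Exports.

Local Open Scope classical_set_scope.
Local Open Scope ring_scope.

(** * Skeletons of invariant subsets *)

Definition stable_by (p : nat) (T : set int) : Prop :=
  forall a, T a -> T (a + p%:Z).

Definition translate (c : int) (T : set int) : set int := [set z | T (z - c)].

(** Admissibility forbids this relation, with [N = n + m], between the classes of
    consecutive residues. *)
Definition precedes (N : nat) (E E' : set int) : Prop :=
  forall z, E' z -> E (z - N%:Z).

Lemma stable_byM p T a (t : nat) : stable_by p T -> T a -> T (a + t%:Z * p%:Z).
Proof.
move=> sT Ta; elim: t => [|t IH]; first by rewrite mul0r addr0.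
by rewrite (_ : _ + _ = a + t%:Z * p%:Z + p%:Z); [exact: sT|lia].
Qed.

Lemma stable_byD p q T : stable_by p T -> stable_by q T -> stable_by (p + q) T.
Proof. by move=> sp sq a Ta; rewrite PoszD addrA; exact/sq/sp. Qed.

Lemma stable_translate p c T : stable_by p T -> stable_by p (translate c T).
Proof. by move=> sT a /sT; rewrite /translate /= addrAC. Qed.

(** By stability a generator [z] has [z + m] in [T] and a cogenerator [z] has
    [z - n] outside, so the union is the difference of [T - m] and [T + n]. *)
Lemma skeletonE n m T z : stable_by n T -> stable_by m T ->
  skeleton n m T z <-> T (z + m%:Z) /\ ~ T (z - n%:Z).
Proof.
move=> sn sm; split=> [[[Tz Tzn]|[Tz Tzm]]|[Tzm Tzn]].
- by split; [exact: sm|].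
- by split=> // /sn; rewrite subrK.
- by case: (pselect (T z)) => Tz; [left|right].
Qed.

Lemma skeleton_translate n m c T z :
  skeleton n m (translate c T) z = skeleton n m T (z - c).
Proof.
rewrite /skeleton /generators /cogenerators /translate /= /setU /=.
by rewrite addrAC [z + m%:Z - c]addrAC.
Qed.

Lemma coprime_residue (n N : nat) (a : int) : (0 < n)%N -> (0 < N)%N ->
  coprime n N -> exists (j : nat) (k : int), j%:Z * n%:Z = a + k * N%:Z.
Proof.
move=> n0 N0 /eqP nN; case: (egcdnP N n0) => u v; rewrite nN => uv _.
exists (`|(a %% N%:Z)%Z|%N * u)%N, ((a %% N%:Z)%Z * v%:Z - (a %/ N%:Z)%Z).
have aN : 0 <= (a %% N%:Z)%Z by apply: modz_ge0; lia.
rewrite {2}(divz_eq a N%:Z) PoszM gez0_abs // -mulrA -PoszM uv PoszD PoszM.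
by ring.
Qed.

(** If [E' precedes E] fails, some class mod [n + m] has its skeleton point of
    [E] below that of [E']. Stability under [n] and [m] carries this to the
    class shifted by [n], where equality is excluded by disjointness, and hence
    to every class since [n] is invertible mod [n + m]. *)
Lemma common_skeleton_or_precedes n m (E E' : set int) (B : int) :
  (0 < n)%N -> coprime n m ->
  stable_by n E -> stable_by m E -> stable_by n E' -> stable_by m E' ->
  (forall z, E z -> B <= z) ->
  (forall z, ~ (skeleton n m E z /\ skeleton n m E' z)) ->
  ~ precedes (n + m) E' E -> precedes (n + m) E E'.
Proof.
move=> n0 nm nE mE nE' mE' EB disj /existsNP[z0 /not_implyP[Ez0 E'z0]] v E'v.
have NE := stable_byD nE mE; have NE' := stable_byD nE' mE'.
set N := (n + m)%N in NE NE' E'z0 *.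
(* [w + m] witnesses that the skeleton point of [E] in the class of [w] lies
   below that of [E']. *)
pose Q (w : int) := E (w + m%:Z) /\ ~ E' (w + m%:Z).
have reduce (w : int) : E (w + m%:Z) -> ~ E' (w - n%:Z) ->
    exists k : int, Q (w + k * N%:Z).
  have [b] := ubnP (absz (w + m%:Z - B)%R).
  elim: b w => // b IH w wb Ew E'w.
  case: (pselect (E (w - n%:Z))) => [Ewn|nEw].
    have := EB _ Ew; have := EB _ Ewn => B1 B2.
    have [] := IH (w - N%:Z).
    - by rewrite /N; lia.
    - by rewrite (_ : _ + _ = w - n%:Z) // /N; lia.
    - move=> /NE'; rewrite (_ : _ + _ = w - n%:Z) //; lia.
    - move=> k Qk; exists (k - 1).
      by rewrite (_ : w + _ = w - N%:Z + k * N%:Z) //; ring.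
  exists 0; rewrite mul0r addr0; split=> // E'wm.
  by apply: (disj w); split; apply/skeletonE.
have [k0 Qz0] : exists k : int, Q (z0 - m%:Z + k * N%:Z).
  apply: reduce; first by rewrite subrK.
  by rewrite -addrA -opprD -PoszD addnC.
set z1 := z0 - m%:Z + k0 * N%:Z in Qz0.
have orbit (j : nat) : exists k : int, Q (z1 + j%:Z * n%:Z + k * N%:Z).
  elim: j => [|j [k [Ew E'w]]]; first by exists 0; rewrite !mul0r !addr0.
  have [||k' Qk'] := reduce (z1 + j%:Z * n%:Z + k * N%:Z + n%:Z).
  - by rewrite addrAC; exact: nE.
  - by rewrite addrK => /mE'.
  exists (k + k'); move: Qk'; congr Q; rewrite -addn1 PoszD; ring.
(* Compare [v], shifted by [m], with the witness in its own class mod [N]. *)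
have [||j [k jk]] := @coprime_residue n N (v - m%:Z - z1) n0.
- by rewrite addn_gt0 n0.
- by rewrite /N /coprime gcdnDl.
have [k' [Ez E'z]] := orbit j.
have vz : v = z1 + j%:Z * n%:Z + k' * N%:Z + m%:Z - (k + k') * N%:Z.
  by rewrite jk; ring.
move: Ez E'z vz; set z := _ + m%:Z => Ez E'z vz.
case: (ltP (k + k') 0) => [kk|kk]; last first.
  case: E'z; rewrite (_ : z = v + (absz (k + k')%R)%:Z * N%:Z).
    exact: stable_byM.
  by rewrite gez0_abs // vz subrK.
rewrite (_ : _ - _ = z + (absz (- (k + k') - 1)%R)%:Z * N%:Z).
  exact: stable_byM.
by rewrite gez0_abs ?vz; [ring|lia].
Qed.

(** * Integer configurations and their residues *)

Section Residues.
Context (d l : nat) (d_gt0 : (0 < d)%N).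
Implicit Types (a b : 'I_l.+1 -> int) (i j f h : 'I_l.+1).

Local Notation level x := (x %/ d%:Z)%Z.
Local Notation rem x := (x %% d%:Z)%Z.

Definition distinct_residues a : Prop :=
  forall i j, (a i = a j %[mod d%:Z])%Z -> i = j.

(** The integer points [(x_0, ..., x_l)], [x_0 = 0], at which the union of the
    dilated sets is a normalized invariant subset. *)
Definition config a : Prop :=
  [/\ a ord0 = 0, forall i, 0 <= a i & distinct_residues a].

Lemma level_rem x : x = d%:Z * level x + rem x.
Proof. by rewrite mulrC -divz_eq. Qed.

Lemma rem_ge0 x : 0 <= rem x.
Proof. by apply: modz_ge0; lia. Qed.

Lemma rem_lt x : rem x < d%:Z.
Proof. by apply: ltz_pmod; lia. Qed.

Lemma level_ge0 x : 0 <= x -> 0 <= level x.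
Proof. by move=> x0; rewrite divz_ge0 //; lia. Qed.

Lemma level_rem_uniq (q r : int) : 0 <= r < d%:Z ->
  level (d%:Z * q + r) = q /\ rem (d%:Z * q + r) = r.
Proof.
move=> rd; rewrite mulrC divzMDl ?modzMDl; last by lia.
by rewrite divz_small ?modz_small ?addr0 //; lia.
Qed.

Lemma residue_classE (r : nat) z : (r < d)%N ->
  residue_class d r z <-> rem z = r%:Z.
Proof.
by move=> rd; rewrite /residue_class /= [(r%:Z %% _)%Z]modz_small //; lia.
Qed.

Lemma config_rem0 a i : config a -> rem (a i) = 0 -> i = ord0.
Proof. by case=> a0 _ da ai; apply: da; rewrite ai a0 mod0z. Qed.

Lemma distinct_residues_neq a i j k : distinct_residues a -> i != j ->
  a i = a j + d%:Z * k -> False.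
Proof.
move=> da ij E; case/eqP: ij; apply: da.
by rewrite E addrC mulrC modzMDl.
Qed.

Lemma residue_surj a t : distinct_residues a ->
  (forall i, rem (a i) <= l%:Z) -> 0 <= t <= l%:Z -> exists f, rem (a f) = t.
Proof.
move=> da al tl.
pose g i : 'I_l.+1 := inord (absz (rem (a i))).
have gE i : (g i)%:Z = rem (a i).
  have := rem_ge0 (a i); have := al i.
  by move=> ? ?; rewrite inordK; lia.
have gi : injective g by move=> i j gij; apply: da; rewrite -!gE gij.
have /codomP[f ft] := injF_onto gi (inord (absz t)).
exists f; rewrite -gE -ft inordK; lia.
Qed.

(** Otherwise all values between 0 and a residue larger than [l] would be
    residues, more than there are indices. *)
Lemma residue_gap a i : distinct_residues a -> l%:Z < rem (a i) ->
  exists2 i0, 0 < rem (a i0) & forall h, rem (a h) != rem (a i0) - 1.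
Proof.
move=> da li; apply: contrapT => nogap.
have down (k : 'I_l.+2) : exists h, rem (a h) = rem (a i) - k%:Z.
  case: k => k /=; elim: k => [|k IH] kl; first by exists i; rewrite subr0.
  have [|h hk] := IH; first by lia.
  apply: contrapT => nh; apply: nogap; exists h; first by lia.
  by move=> h'; apply/eqP => E; apply: nh; exists h'; lia.
have [g gE] := choice down.
have gi : injective g.
  by move=> k k' E; apply: val_inj => /=; have := gE k; rewrite E gE; lia.
by have := leq_card g gi; rewrite !card_ord ltnn.
Qed.

End Residues.

(** * Order of the skeleton points of a configuration *)

Section Configurations.
Context (n m d l : nat).

Local Notation level x := (x %/ d%:Z)%Z.
Local Notation rem x := (x %% d%:Z)%Z.

Definition invariant_family (Theta : 'I_l.+1 -> set int) : Prop :=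
  forall k, invariant_subset n m (Theta k) /\ zero_normalized (Theta k).

Context (Theta : 'I_l.+1 -> set int).
Implicit Types (a b : 'I_l.+1 -> int) (i j e f h : 'I_l.+1).

(** One implication suffices: by distinctness of residues no two of the
    compared points coincide, see [same_order_sym]. *)
Definition same_order a b : Prop :=
  forall i j s t, i != j ->
    skeleton n m (Theta i) s -> skeleton n m (Theta j) t ->
    d%:Z * s + a i < d%:Z * t + a j -> d%:Z * s + b i < d%:Z * t + b j.

(** The class of residue [rem (a i)] of the subset built from [a], after
    subtracting its residue and dividing by [d]. *)
Definition contracted a i : set int := translate (level (a i)) (Theta i).

(** Linked classes have skeleton points on a common level, whose order is
    decided by the residues alone. *)
Definition linked a i j : Prop :=
  exists z, skeleton n m (contracted a i) z /\ skeleton n m (contracted a j) z.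

Definition admissible_config a : Prop :=
  (forall i, rem (a i) <= l%:Z) /\
  (forall i j, rem (a j) = rem (a i) + 1 ->
     ~ precedes (n + m) (contracted a i) (contracted a j)).

Lemma same_order_trans a b c : same_order a b -> same_order b c ->
  same_order a c.
Proof. by move=> ab bc i j s t ij Si Sj /(ab _ _ _ _ ij Si Sj)/bc; apply. Qed.

Lemma same_order_shift a b (c : int) : (forall i, b i = a i + c) ->
  same_order a b.
Proof. by move=> ba i j s t _ _ _; rewrite !ba !addrA ltrD2r. Qed.

Lemma same_order_sym a b : distinct_residues d a -> same_order a b ->
  same_order b a.
Proof.
move=> da ab i j s t ij Si Sj bij; rewrite ltNge; apply/negP.
rewrite le_eqVlt => /orP[/eqP E|lt].
  case/eqP: ij; apply: da; apply/eqP; rewrite eqz_mod_dvd.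
  by rewrite (_ : _ - _ = (t - s) * d%:Z) ?dvdz_mull //; lia.
rewrite eq_sym in ij.
by have := ab _ _ _ _ ij Sj Si lt; lia.
Qed.

Context (d_gt0 : (0 < d)%N) (Theta_family : invariant_family Theta).

Lemma contracted_stable_n a i : stable_by n (contracted a i).
Proof. by apply: stable_translate; case: (Theta_family i) => -[]. Qed.

Lemma contracted_stable_m a i : stable_by m (contracted a i).
Proof. by apply: stable_translate; case: (Theta_family i) => -[]. Qed.

Lemma contracted_ge a i z : contracted a i z -> level (a i) <= z.
Proof. by case: (Theta_family i) => -[T0 _ _] _ /T0; rewrite subr_ge0. Qed.

Lemma contracted_level a i : contracted a i (level (a i)).
Proof.
by rewrite /contracted /translate /= subrr; exact: (Theta_family i).2.
Qed.

Lemma precedes_not_linked a i j :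
  precedes (n + m) (contracted a i) (contracted a j) -> ~ linked a i j.
Proof.
move=> ij [z [/skeletonE Si /skeletonE Sj]].
have {Si}[_ Siz] := Si (@contracted_stable_n _ _) (@contracted_stable_m _ _).
have {Sj}[Sjz _] := Sj (@contracted_stable_n _ _) (@contracted_stable_m _ _).
by apply: Siz; have := ij _ Sjz; rewrite (_ : _ - _ = z - n%:Z) //; lia.
Qed.

Lemma precedes_trans a i j k :
  precedes (n + m) (contracted a i) (contracted a j) ->
  precedes (n + m) (contracted a j) (contracted a k) ->
  precedes (n + m) (contracted a i) (contracted a k).
Proof.
move=> ij jk z /jk/ij.
move/(stable_byD (@contracted_stable_n a i) (@contracted_stable_m a i)).
by rewrite subrK.
Qed.

(** The level of a class is the smallest element of the contracted set. *)
Lemma precedes_level a i j :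
  precedes (n + m) (contracted a i) (contracted a j) ->
  level (a i) + (n + m)%:Z <= level (a j).
Proof.
by move/(_ _ (contracted_level a j))/contracted_ge; rewrite lerBrDr.
Qed.

(** A common skeleton point [z] yields points on level [z] of both classes.
    Their order is fixed by the residues in [a], and persists in [b], where the
    levels have moved by [level (b i) - level (a i)] and
    [level (b j) - level (a j)]. *)
Lemma linked_order a b i j : i != j -> same_order a b -> linked a i j ->
  rem (a i) < rem (a j) ->
  level (b i) - level (a i) <= level (b j) - level (a j) /\
  (level (b i) = level (a i) -> level (b j) = level (a j) ->
   rem (b i) < rem (b j)).
Proof.
move=> ij ab [z []]; rewrite !skeleton_translate => Si Sj rij.
have := ab _ _ _ _ ij Si Sj.
have := level_rem d (a i); have := level_rem d (a j).
have := level_rem d (b i); have := level_rem d (b j).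
have := rem_ge0 d_gt0 (b i); have := rem_lt d_gt0 (b j).
move: (level (a i)) (level (a j)) (level (b i)) (level (b j)) rij.
move: (rem (a i)) (rem (a j)) (rem (b i)) (rem (b j)).
move=> ri rj si sj ui uj vi vj rij sjd si0 -> -> -> -> H.
have {}H : d%:Z * (z - ui + vi) + si < d%:Z * (z - uj + vj) + sj.
  suff: d%:Z * (z - ui) + (d%:Z * vi + si) < d%:Z * (z - uj) + (d%:Z * vj + sj).
    by lia.
  apply: H; rewrite !mulrBr; lia.
split; last by move=> e1 e2; move: H; rewrite e1 e2 !subrK; lia.
by rewrite leNgt; apply/negP => vu; nia.
Qed.

(** * Existence of an admissible configuration *)

Section Existence.
Context (nm_gt0 : (0 < n + m)%N).

Definition energy a : int := \sum_i a i ^+ 2.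

Lemma energy_lt a b i : (forall h, 0 <= b h <= a h) -> b i < a i ->
  energy b < energy a.
Proof.
move=> ba bi; rewrite /energy (bigD1 i) //= [ltRHS](bigD1 i) //=.
apply: ltr_leD; first by have := ba i; nia.
by apply: ler_sum => h _; have := ba h; nia.
Qed.

Definition decrement a i0 : 'I_l.+1 -> int :=
  fun h => if h == i0 then a h - 1 else a h.

(** No skeleton point can meet one of another class while moving down by one,
    since the residue it reaches is free. *)
Lemma decrement_config a i0 : config d a -> 0 < rem (a i0) ->
  (forall h, rem (a h) != rem (a i0) - 1) ->
  [/\ config d (decrement a i0), same_order a (decrement a i0)
    & energy (decrement a i0) < energy a].
Proof.
move=> [a0 age da] r0 gap.
have gapN h k : a h = a i0 - 1 + d%:Z * k -> False.
  move=> E; case/eqP: (gap h).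
  have -> : a h = (level (a i0) + k) * d%:Z + (rem (a i0) - 1).
    by rewrite E {1}(level_rem d (a i0)); ring.
  rewrite modzMDl modz_small //; have := rem_lt d_gt0 (a i0); lia.
have a1 : 1 <= a i0.
  by have := level_rem d (a i0); have := level_ge0 d_gt0 (age i0); nia.
have i00 : ord0 != i0 by apply: contraTneq r0 => <-; rewrite a0 mod0z.
have eqm x y : (x = y %[mod d%:Z])%Z -> exists k, x = y + d%:Z * k.
  move/eqP; rewrite eqz_mod_dvd => /dvdzP[k E]; exists k; lia.
split; first split.
- by rewrite /decrement (negPf i00).
- by move=> i; rewrite /decrement; case: eqP => [->|_]; [lia|exact: age].
- move=> i j; rewrite /decrement.
  case: eqVneq => [->|ii]; case: eqVneq => [->|jj] //.
  + by move/esym/eqm => [k /gapN].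
  + by move/eqm => [k /gapN].
  + exact: da.
- move=> i j s t ij _ _; rewrite /decrement.
  case: (eqVneq i i0) ij => [->|ii]; case: (eqVneq j i0) => [->|jj] //.
  + by lia.
  + move=> _ lt; rewrite ltNge; apply: contra_notN (@gapN i (t - s)) => le.
    by lia.
- apply: (@energy_lt _ _ i0); last by rewrite /decrement eqxx; lia.
  by move=> h; rewrite /decrement; case: eqP => [->|]; have := age h; lia.
Qed.

Definition exchange a i0 j0 : 'I_l.+1 -> int :=
  fun h => if h == i0 then a h + 1 else if h == j0 then a h - 1 else a h.

(** The residues are merely permuted, so a third class is never met. Points of
    the two exchanged classes can only cross if they lie on the same level,
    which would be a common skeleton point. *)
Lemma exchange_config a i0 j0 : distinct_residues d a ->
  rem (a j0) = rem (a i0) + 1 ->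
  precedes (n + m) (contracted a i0) (contracted a j0) ->
  [/\ i0 != j0, distinct_residues d (exchange a i0 j0)
    & same_order a (exchange a i0 j0)].
Proof.
move=> da ra pij.
have i0j0 : i0 != j0 by apply/eqP => E; move: ra; rewrite E; lia.
have [k0 ak0] : exists k0, a j0 = a i0 + 1 + d%:Z * k0.
  exists (level (a j0) - level (a i0)).
  by rewrite {1}(level_rem d (a j0)) {1}(level_rem d (a i0)) ra; ring.
have k0E : level (a j0) = level (a i0) + k0.
  have := level_rem d (a j0); rewrite ak0 {1}(level_rem d (a i0)) -ak0 ra => E.
  have : d%:Z * (level (a j0) - (level (a i0) + k0)) = 0 by lia.
  by move/eqP; rewrite mulf_eq0 subr_eq0 => /orP[|/eqP//]; lia.
have d1 : (1 < d)%N.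
  by have := rem_lt d_gt0 (a j0); have := rem_ge0 d_gt0 (a i0); lia.
split=> //.
- have E h : exists k, exchange a i0 j0 h = a (tperm i0 j0 h) + k * d%:Z.
    rewrite /exchange; case: tpermP => [->|->|/eqP/negPf-> /eqP/negPf->].
    + by exists (- k0); rewrite eqxx ak0; ring.
    + by exists k0; rewrite eq_sym (negPf i0j0) eqxx ak0; ring.
    + by exists 0; rewrite mul0r addr0.
  move=> i j; have [ki ->] := E i; have [kj ->] := E j.
  by rewrite ![_ + _ * _]addrC !modzMDl => /da/perm_inj.
- move=> i j s t ij Si Sj; rewrite /exchange.
  have unlinked : i = i0 -> j = j0 -> s = t + k0 -> False.
    move=> ii jj st; apply: (precedes_not_linked pij).
    exists (s + level (a i0)); rewrite !skeleton_translate addrK k0E -ii -jj.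
    by split=> //; rewrite st (_ : _ - _ = t) //; ring.
  have neq := distinct_residues_neq da.
  case: (eqVneq i i0) ij unlinked => [->|ii]; case: (eqVneq j i0) => [->|ji0].
  + by [].
  + case: (eqVneq j j0) => [->|jj] _ unlinked lt.
      have {}unlinked : t + k0 - s <> 0 by move=> ?; apply: unlinked => //; lia.
      have : 0 < d%:Z * (t + k0 - s) + 1 by lia.
      have : 0 <= t + k0 - s \/ t + k0 - s <= -1 by lia.
      case=> [K _|K]; last by nia.
      have : d%:Z * (t + k0 - s) >= 2 by nia.
      by lia.
    rewrite ltNge; apply: contra_notN (@neq j j0 (s - t - k0) jj) => le.
    by lia.
  + move=> _ _; case: eqVneq => _; lia.
  + move=> ij _.
    case: (eqVneq i j0) => [ij0|ij0]; case: (eqVneq j j0) => [jj0|jj0].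
    * by case/eqP: ij; rewrite ij0 jj0.
    * by lia.
    * move=> lt; rewrite ltNge.
      apply: contra_notN (@neq i i0 (t + k0 - s) ii) => le.
      by rewrite jj0 in le lt; lia.
    * by [].
Qed.

(** When an exchange involves the class of 0, every coordinate is afterwards
    translated by -1 in order to restore [a 0 = 0]; then no coordinate
    increases. *)
Lemma energy_descent a : config d a -> ~ admissible_config a ->
  exists b, [/\ config d b, same_order a b & energy b < energy a].
Proof.
move=> ca; have [a0 age da] := ca.
case/not_andP => [/existsNP[i /negP]|].
  rewrite -ltNge => /(residue_gap d_gt0 da)[i0 r0 gap].
  by exists (decrement a i0); exact: decrement_config.
move=> /existsNP[i0 /existsNP[j0 /not_implyP[ra /contrapT pij]]].
have [ij de oe] := exchange_config da ra pij.
have i0v : exchange a i0 j0 i0 = a i0 + 1 by rewrite /exchange eqxx.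
have j0v : exchange a i0 j0 j0 = a j0 - 1.
  by rewrite /exchange eq_sym (negPf ij) eqxx.
have hv h : h != i0 -> h != j0 -> exchange a i0 j0 h = a h.
  by rewrite /exchange => /negPf-> /negPf->.
have ri := rem_ge0 d_gt0 (a i0).
have j00 : j0 != ord0.
  by apply/eqP => E; move: ra; rewrite E a0 mod0z; lia.
have lv := precedes_level pij.
have pos h : h != ord0 -> 1 <= a h.
  move=> h0; rewrite -gtz0_ge1 lt_neqAle age andbT eq_sym.
  by apply: contra h0 => /eqP E; apply/eqP/(config_rem0 ca); rewrite E mod0z.
case: (eqVneq i0 ord0) => [i00|i00].
- rewrite i00 in i0v hv lv ij; rewrite i00 in de oe j0v.
  have aj : 2 <= a j0.
    move: lv; rewrite a0 div0z add0r.
    by have := level_rem d (a j0); have := rem_ge0 d_gt0 (a j0); nia.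
  (* The exchange moves the class of 0 to 1. *)
  pose b h := exchange a ord0 j0 h + (-1).
  have bv h : 0 <= b h <= a h.
    rewrite /b; case: (eqVneq h ord0) => [->|h0]; first by rewrite i0v a0.
    case: (eqVneq h j0) => [->|hj]; first by rewrite j0v; lia.
    by rewrite hv //; have := pos h h0; lia.
  exists b; split.
  + split; first by rewrite /b i0v a0.
      by move=> h; case/andP: (bv h).
    move=> h h' E; apply: de; apply/eqP.
    by move/eqP: E; rewrite /b eqz_modDr.
  + by apply: (same_order_trans oe); exact: same_order_shift.
  + by apply: (@energy_lt _ _ j0 bv); rewrite /b j0v; lia.
- have ai := pos _ i00; have aj := pos _ j00.
  exists (exchange a i0 j0); split=> //.
    split=> //; first by rewrite hv // eq_sym.
    move=> h; case: (eqVneq h i0) => [->|hi]; first by rewrite i0v; lia.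
    case: (eqVneq h j0) => [->|hj]; first by rewrite j0v; lia.
    by rewrite hv.
  have ji : j0 != i0 by rewrite eq_sym.
  rewrite /energy (bigD1 i0) //= [X in _ + X](bigD1 j0) //=.
  rewrite [ltRHS](bigD1 i0) //= [X in _ < _ + X](bigD1 j0) //=.
  rewrite i0v j0v !addrA.
  rewrite (eq_bigr (fun h => a h ^+ 2)) ?ltrD2r; last first.
    by move=> h /andP[hi hj]; rewrite hv.
  have : a i0 + 1 < a j0.
    rewrite (level_rem d (a i0)) (level_rem d (a j0)) ra.
    have : d%:Z * (level (a i0) + 1) <= d%:Z * level (a j0).
      by apply: ler_wpM2l => //; lia.
    by rewrite mulrDr mulr1; lia.
  nia.
Qed.

Lemma admissible_config_exists a : config d a ->
  exists b, [/\ config d b, same_order a b & admissible_config b].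
Proof.
have [k] := ubnP (absz (energy a)); elim: k a => // k IH a ak ca.
case: (pselect (admissible_config a)) => [aa|naa].
  by exists a; split=> // i j s t _ _ _.
have [b [cb ab lt]] := energy_descent ca naa.
have eb : 0 <= energy b by apply: sumr_ge0 => h _; exact: sqr_ge0.
have [||c [cc bc ac]] := IH b; [lia|by []|].
by exists c; split=> //; exact: same_order_trans bc.
Qed.

End Existence.

(** * Uniqueness of the admissible configuration *)

Section Uniqueness.
Context (n_gt0 : (0 < n)%N) (nm_coprime : coprime n m).

Lemma linked_or_precedes a i j : ~ linked a i j ->
  precedes (n + m) (contracted a i) (contracted a j) \/
  precedes (n + m) (contracted a j) (contracted a i).
Proof.
move=> nL; case: (pselect (precedes (n + m) (contracted a j) (contracted a i))).
  by right.
move=> nP; left; apply: (common_skeleton_or_precedes (B := level (a i))) => //;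
  try exact: contracted_stable_n; try exact: contracted_stable_m.
- by move=> z; exact: contracted_ge.
- by move=> z Sz; apply: nL; exists z.
Qed.

(** Walk up through the residues from [e]: every class met before [f] precedes
    [f], since a class preceded by [f] would, right after one that precedes
    [f], contradict admissibility by transitivity. The last step to [f] is
    itself excluded by admissibility. *)
Lemma no_unlinked_chain a e f : distinct_residues d a -> admissible_config a ->
  rem (a e) < rem (a f) ->
  precedes (n + m) (contracted a e) (contracted a f) ->
  (forall h, rem (a e) < rem (a h) < rem (a f) -> ~ linked a h f) -> False.
Proof.
move=> da [al aP]; have [k] := ubnP (absz (rem (a f) - rem (a e))%R).
elim: k e => // k IH e ek ef pef nL.
have [|h he] := residue_surj (t := rem (a e) + 1) d_gt0 da al.
  by have := rem_ge0 d_gt0 (a e); have := al f; lia.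
case: (eqVneq h f) => [hf|hf]; first by apply: (aP e f) => //; rewrite -hf.
have hlt : rem (a h) < rem (a f).
  rewrite lt_neqAle; apply/andP; split; last by lia.
  by apply: contra hf => /eqP/da ->.
have hL : ~ linked a h f by apply: nL; lia.
case: (linked_or_precedes hL) => [phf|pfh].
- by apply: (IH h) => //; [lia|move=> h' h'P; apply: nL; lia].
- exact: (aP e h he (precedes_trans pef pfh)).
Qed.

(** Every class other than that of 0 is linked to one of smaller residue:
    otherwise it would be unlinked from the class of 0, which then precedes it
    by nonnegativity, and [no_unlinked_chain] applies. Along links the gain in
    level cannot decrease. *)
Lemma admissible_level_le a b i : config d a -> config d b ->
  admissible_config a -> same_order a b -> level (a i) <= level (b i).
Proof.
move=> ca cb aa ab; have [k] := ubnP (absz (rem (a i))).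
elim: k i => // k IH i ik.
have [a0 age da] := ca; have [b0 _ _] := cb.
case: (eqVneq i ord0) => [->|i0]; first by rewrite a0 b0.
have ri : 0 < rem (a i).
  rewrite lt_neqAle rem_ge0 // andbT eq_sym.
  by apply: contra i0 => /eqP/(config_rem0 ca) ->.
have r0 : rem (a ord0) = 0 by rewrite a0 mod0z.
suff [j [ji jL]] : exists j, rem (a j) < rem (a i) /\ linked a j i.
  have jNi : j != i by apply: contraTN ji => /eqP ->; rewrite ltxx.
  have [le _] := linked_order jNi ab jL ji.
  have := IH j; have := rem_ge0 d_gt0 (a j); lia.
apply: contrapT => nL.
have {}nL j : rem (a j) < rem (a i) -> ~ linked a j i.
  by move=> ji jL; apply: nL; exists j.
have L0 : ~ linked a ord0 i by apply: nL; rewrite r0.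
case: (linked_or_precedes L0) => [p0i|pi0].
  apply: (no_unlinked_chain da aa _ p0i); first by rewrite r0.
  by move=> h hP; apply: nL; lia.
have := precedes_level pi0; have := level_ge0 d_gt0 (age i).
by rewrite a0 div0z; lia.
Qed.

Lemma admissible_config_unique a b : config d a -> config d b ->
  admissible_config a -> admissible_config b -> same_order a b -> a = b.
Proof.
move=> ca cb aa bb ab; have [a0 age da] := ca; have [b0 bge db] := cb.
have ba := same_order_sym da ab.
have lE i : level (a i) = level (b i).
  by apply/eqP; rewrite eq_le !admissible_level_le.
have qE i : contracted a i = contracted b i by rewrite /contracted lE.
have [[al _] [bl _]] := (aa, bb).
suff rE (k : nat) i : rem (a i) = k%:Z -> rem (b i) = k%:Z.
  apply/funext => i; rewrite (level_rem d (a i)) (level_rem d (b i)) lE.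
  have ri := rem_ge0 d_gt0 (a i).
  by rewrite (rE (absz (rem (a i))) i) ?gez0_abs.
elim/ltn_ind: k i => k IH i ai.
have kl : 0 <= k%:Z <= l%:Z by have := al i; lia.
have rab j : rem (a j) < k%:Z -> rem (b j) = rem (a j).
  move=> jk; have := rem_ge0 d_gt0 (a j).
  by have := IH (absz (rem (a j))) _ j; lia.
have rba j : rem (b j) < k%:Z -> rem (a j) = rem (b j).
  move=> jk; have [|j' j'b] := residue_surj (t := rem (b j)) d_gt0 da al.
    by rewrite bl rem_ge0.
  by rewrite -{1}(db j' j) // rab j'b.
(* Smaller residues agree, so [i] and the index [h] of residue [k] in [b] occur
   in opposite orders in [a] and [b], unless they are equal. *)
have [h hb] := residue_surj d_gt0 db bl kl.
apply: contrapT => /eqP bi.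
have bik : k%:Z < rem (b i).
  by rewrite ltNge le_eqVlt (negPf bi) /=; apply/negP => /[dup] /rba; lia.
have hi : h != i by apply: contraNneq bi => <-; rewrite hb.
have ahk : k%:Z < rem (a h).
  rewrite ltNge le_eqVlt; apply/negP => /orP[/eqP ah|/[dup]/rab]; last by lia.
  by case/eqP: hi; apply: da; rewrite ah ai.
have La f : k%:Z <= rem (a f) -> rem (a f) < rem (a h) -> ~ linked a f h.
  move=> kf fh fL.
  have fNh : f != h by apply: contraTneq fh => ->; rewrite ltxx.
  have [_ /(_ (esym (lE _)) (esym (lE _)))] := linked_order fNh ab fL fh.
  by rewrite hb => /[dup] /rba; lia.
have Lb f : k%:Z <= rem (b f) -> rem (b f) < rem (b i) -> ~ linked b f i.
  move=> kf fi fL.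
  have fNi : f != i by apply: contraTneq fi => ->; rewrite ltxx.
  have [_ /(_ (lE _) (lE _))] := linked_order fNi ba fL fi.
  by rewrite ai => /[dup] /rab; lia.
have ih : ~ linked a i h by apply: La; rewrite ai.
case: (linked_or_precedes ih) => [pih|phi].
- apply: (no_unlinked_chain da aa _ pih); first by rewrite ai.
  by move=> f fP; apply: La; lia.
- rewrite !qE in phi.
  apply: (no_unlinked_chain db bb _ phi); first by rewrite hb.
  by move=> f fP; apply: Lb; lia.
Qed.

End Uniqueness.

End Configurations.

(** * Invariant subsets as unions of residue classes *)

Section Assembly.
Context (n m d l : nat) (d_gt0 : (0 < d)%N).
Implicit Types (Theta : 'I_l.+1 -> set int) (a b : 'I_l.+1 -> int).

Local Notation level x := (x %/ d%:Z)%Z.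
Local Notation rem x := (x %% d%:Z)%Z.

Definition assemble Theta a : set int :=
  [set z | exists k s, Theta k s /\ z = d%:Z * s + a k].

Lemma assembleE Theta a z : assemble Theta a z <->
  exists k, rem (a k) = rem z /\ contracted d Theta a k (level z).
Proof.
split=> [[k [s [Ts ->]]]|[k [rk Qk]]].
  exists k; rewrite mulrC modzMDl divzMDl; last by lia.
  by rewrite /contracted /translate /= addrK.
exists k, (level z - level (a k)); split=> //.
by rewrite {1}(level_rem d z) {2}(level_rem d (a k)) rk; ring.
Qed.

Lemma assemble_residue Theta a k s : config d a ->
  assemble Theta a (d%:Z * s + a k) <-> Theta k s.
Proof.
move=> [_ _ da]; rewrite assembleE mulrC modzMDl divzMDl; last by lia.
split=> [[k' [/da-> ]]|Ts].
  by rewrite /contracted /translate /= addrK.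
by exists k; rewrite /contracted /translate /= addrK.
Qed.

(** A subset determines its residue classes and their minima, so two writings
    of it differ by a relabelling only. *)
Lemma assemble_inj Theta Theta' a a' :
  invariant_family n m Theta -> invariant_family n m Theta' ->
  config d a -> config d a' -> assemble Theta a = assemble Theta' a' ->
  forall k, exists k', a' k' = a k /\ Theta' k' = Theta k.
Proof.
move=> fT fT' ca ca' E k.
have [k' [s [Ts sE]]] : assemble Theta' a' (a k).
  by rewrite -E; exists k, 0; split; [exact: (fT k).2|rewrite mulr0 add0r].
have [k'' [s' [Ts' sE']]] : assemble Theta a (a' k').
  by rewrite E; exists k', 0; split; [exact: (fT' k').2|rewrite mulr0 add0r].
have kk : k'' = k.
  case: ca => _ _; apply; rewrite sE sE' mulrC modzMDl.
  by rewrite mulrC modzMDl.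
rewrite kk in Ts' sE'.
have s0 : 0 <= s by case: (fT' k') => -[+ _ _] _; apply.
have s0' : 0 <= s' by case: (fT k) => -[+ _ _] _; apply.
have aE : a' k' = a k by nia.
exists k'; split=> //; apply/funext => u; apply/propext.
rewrite -(assemble_residue Theta' k' u ca').
by rewrite -(assemble_residue Theta k u ca) E aE.
Qed.

Lemma assemble_bij Theta a (p : 'I_l.+1 -> 'I_l.+1) : bijective p ->
  assemble (Theta \o p) (a \o p) = assemble Theta a.
Proof.
case=> q pq qp; apply/funext => z; apply/propext; split=> -[k [s [Ts zE]]].
  by exists (p k), s.
by exists (q k), s; rewrite /= qp.
Qed.

Lemma assemble_shift Theta a k :
  invariant_family n m Theta -> assemble Theta a (a k).
Proof.
by move=> fT; exists k, 0; split; [exact: (fT k).2|rewrite mulr0 add0r].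
Qed.

Lemma assemble0 Theta a : invariant_family n m Theta -> config d a ->
  zero_normalized (assemble Theta a).
Proof.
by move=> fT [a0 _ _]; rewrite /zero_normalized -a0; exact: assemble_shift.
Qed.

Lemma assemble_invariant Theta a : invariant_family n m Theta -> config d a ->
  invariant_subset (n * d) (m * d) (assemble Theta a).
Proof.
move=> fT [_ age _]; split.
- move=> _ [k [s [Ts ->]]]; apply: addr_ge0 => //; apply: mulr_ge0 => //.
  by case: (fT k) => -[+ _ _] _; apply.
- move=> _ [k [s [Ts ->]]]; exists k, (s + n%:Z).
  split; last by rewrite PoszM; ring.
  by case: (fT k) => -[_ + _] _; apply.
- move=> _ [k [s [Ts ->]]]; exists k, (s + m%:Z).
  split; last by rewrite PoszM; ring.
  by case: (fT k) => -[_ _ +] _; apply.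
Qed.

Lemma assemble_normalized Theta a : invariant_family n m Theta -> config d a ->
  normalized_subsets m n d l (assemble Theta a).
Proof.
move=> fT ca; split; [exact: assemble_invariant|exact: assemble0|].
have gP k : (absz (rem (a k)) < d)%N.
  by have := rem_ge0 d_gt0 (a k); have := rem_lt d_gt0 (a k); lia.
pose g k : 'I_d := Ordinal (gP k).
have gE k : (g k)%:Z = rem (a k) by rewrite /= gez0_abs // rem_ge0.
have gi : injective g.
  by case: ca => _ _ da i j gij; apply: da; rewrite -!gE gij.
rewrite /num_residues -[RHS]card_ord -(card_codom gi); apply: eq_card => r.
rewrite inE; apply/asboolP/codomP => [[z [Dz]]|[k ->]].
  move/(residue_classE z (ltn_ord r)) => zr.
  have [k [kz _]] := (assembleE Theta a z).1 Dz.
  by exists k; apply: val_inj; have := gE k; rewrite kz zr => -[].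
exists (a k); split; first exact: assemble_shift.
by apply/residue_classE.
Qed.

Lemma set_int_min (A : set int) : A !=set0 -> (forall z, A z -> 0 <= z) ->
  exists2 a, A a & forall z, A z -> a <= z.
Proof.
case=> z0 Az0 A0; have [k] := ubnP (absz z0).
elim: k z0 Az0 => // k IH z0 Az0 zk.
case: (pselect (exists2 z, A z & z < z0)) => [[z Az zz]|nz].
  by apply: (IH z Az); have := A0 _ Az; have := A0 _ Az0; lia.
exists z0 => // z Az; rewrite leNgt; apply/negP => zz; apply: nz.
by exists z.
Qed.

(** The sets [Theta k] are the residue classes, contracted after moving their
    minimum to 0; the class of 0 has to receive the label 0. *)
Lemma normalized_assemble D : normalized_subsets m n d l D ->
  exists Theta a,
    [/\ invariant_family n m Theta, config d a & D = assemble Theta a].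
Proof.
case=> [[D0 Dn Dm] Dz Dl].
set A := [pred r : 'I_d | `[< D `&` residue_class d r !=set0 >] ].
have cA : #|A| = l.+1 by [].
have r0A : Ordinal d_gt0 \in A by rewrite inE; exists 0.
(* Swap labels so that the class of 0 comes first. *)
pose i0 := cast_ord cA (enum_rank_in r0A (Ordinal d_gt0)).
pose g k := enum_val (cast_ord (esym cA) (tperm ord0 i0 k)).
have g0 : g ord0 = Ordinal d_gt0.
  by rewrite /g tpermL /i0 cast_ordK enum_rankK_in.
have gA k : g k \in A by exact: enum_valP.
have gi : injective g by move=> i j /enum_val_inj/cast_ord_inj/perm_inj.
have gsurj r : r \in A -> exists k, g k = r.
  move=> rA; exists (tperm ord0 i0 (cast_ord cA (enum_rank_in r0A r))).
  by rewrite /g tpermK cast_ordK enum_rankK_in.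
have /choice[a aP] k : exists a : int, [/\ D a, rem a = (g k)%:Z
    & forall z, D z -> rem z = (g k)%:Z -> a <= z].
  have [||a [Da ra] amin] := @set_int_min (D `&` residue_class d (g k)).
  - by have := gA k; rewrite inE.
  - by move=> z [/D0].
  exists a; split=> //; first exact/residue_classE.
  by move=> z Dz' rz; apply: amin; split=> //; apply/residue_classE.
exists (fun k => [set s | D (d%:Z * s + a k)]), a.
have rem_shift k s : rem (d%:Z * s + a k) = rem (a k) by rewrite mulrC modzMDl.
have [a_ge0 aD] : (forall k, 0 <= a k) /\ (forall k, D (a k)).
  by split=> k; case: (aP k) => // /D0.
split.
- move=> k; split; last by rewrite /zero_normalized /= mulr0 add0r.
  split=> s /= Ds.
  + case: (aP k) => _ ra /(_ _ Ds); rewrite rem_shift => /(_ ra).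
    by rewrite -subr_ge0 addrK pmulr_rge0.
  + by move/Dn: Ds; rewrite PoszM mulrDr [_ * n%:Z]mulrC addrAC.
  + by move/Dm: Ds; rewrite PoszM mulrDr [_ * m%:Z]mulrC addrAC.
- split=> //.
  + apply/eqP; rewrite eq_le a_ge0 andbT.
    by case: (aP ord0) => _ _; apply=> //; rewrite g0 mod0z.
  + move=> i j E; apply: gi; apply: val_inj.
    by case: (aP i) (aP j) => _ ri _ [_ rj _]; have := ri; rewrite E rj => -[].
- apply/funext => z; apply/propext; split=> [Dz'|[k [s [+ ->]]] //].
  have rP : (absz (rem z) < d)%N.
    by have := rem_ge0 d_gt0 z; have := rem_lt d_gt0 z; lia.
  have rE : rem z = (absz (rem z))%:Z by rewrite gez0_abs // rem_ge0.
  have [k gk] : exists k, g k = Ordinal rP.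
    apply: gsurj; rewrite inE; exists z; split=> //.
    exact/residue_classE.
  have [_ ra _] := aP k; rewrite gk /= -rE in ra.
  have zE : z = d%:Z * (level z - level (a k)) + a k.
    by rewrite {1}(level_rem d z) {2}(level_rem d (a k)) ra; ring.
  by exists k, (level z - level (a k)); rewrite /= -zE.
Qed.

Lemma admissible_assemble Theta a : invariant_family n m Theta -> config d a ->
  admissible m n d l (assemble Theta a) -> admissible_config n m d Theta a.
Proof.
move=> fT ca [_ _ empty step]; have [_ _ da] := ca.
have al i : rem (a i) <= l%:Z.
  rewrite leNgt; apply/negP => li.
  have ri := rem_lt d_gt0 (a i); have ri0 := rem_ge0 d_gt0 (a i).
  have : (assemble Theta a `&` residue_class d (absz (rem (a i)))) (a i).
    split; first exact: assemble_shift.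
    by apply/residue_classE; lia.
  by rewrite empty; first by []; lia.
split=> // i j rij pij; have ri0 := rem_ge0 d_gt0 (a i).
have rj := al j; have rjd := rem_lt d_gt0 (a j).
apply: (step (absz (rem (a i)))); first by lia.
move=> z [/assembleE[k [rk Qk]] /residue_classE rz].
have {}rz : rem z = rem (a j) by rewrite rz; lia.
have kj : k = j by apply: da; rewrite rk rz.
have ri : 0 <= rem (a i) < d%:Z by lia.
rewrite kj in Qk.
have [lE rE] := level_rem_uniq d_gt0 (level z - (n + m)%:Z) ri.
exists (d%:Z * (level z - (n + m)%:Z) + rem (a i)); last first.
  by rewrite {2}(level_rem d z) rz rij !PoszM PoszD; ring.
split; last by apply/residue_classE; lia.
by apply/assembleE; exists i; rewrite rE lE; split=> //; exact: pij.
Qed.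

Lemma assemble_admissible Theta a : (l < d)%N -> invariant_family n m Theta ->
  config d a -> admissible_config n m d Theta a ->
  admissible m n d l (assemble Theta a).
Proof.
move=> ld fT ca [al aP]; have [_ _ da] := ca; split.
- by split; [exact: assemble_invariant|exact: assemble0].
- move=> r rl.
  have [|f fr] := residue_surj (t := r%:Z) d_gt0 da al; first by lia.
  exists (a f); split; first exact: assemble_shift.
  by apply/residue_classE => //; lia.
- move=> r /andP[lr rd]; apply/seteqP; split=> // z [/assembleE[k [rk _]]].
  by move/(residue_classE _ rd); have := al k; lia.
move=> k kl incl.
have [|i ik] := residue_surj (t := k%:Z) d_gt0 da al; first by lia.
have [|j jk] := residue_surj (t := k.+1%:Z) d_gt0 da al; first by lia.
apply: (aP i j); first by lia.
move=> z Qz.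
have kd : 0 <= k%:Z < d%:Z by lia.
have k1d : 0 <= k.+1%:Z < d%:Z by lia.
have [lE rE] := level_rem_uniq d_gt0 z k1d.
have [] := incl (d%:Z * z + k.+1%:Z).
  split; last by apply/residue_classE => //; lia.
  by apply/assembleE; exists j; rewrite rE lE.
move=> y [Dy _] yE.
have {}yE : y = d%:Z * (z - (n + m)%:Z) + k%:Z.
  by move: yE; rewrite !PoszM PoszD -addn1 PoszD; lia.
have [lE' rE'] := level_rem_uniq d_gt0 (z - (n + m)%:Z) kd.
move: Dy; rewrite yE => /assembleE[h []]; rewrite rE' lE' => hk.
by rewrite (da h i) // hk ik.
Qed.

End Assembly.

(** * Connected components of the arrangement *)

Lemma component_sign (R : realType) (T : topologicalType) (A : set T)
    (f : T -> R) (x y : T) :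
  continuous f -> (forall z, A z -> f z != 0) ->
  connected_component A x y -> 0 < f x -> 0 < f y.
Proof.
move=> fc f0 [C [Cx CA Cc] Cy] fx; rewrite ltNge; apply/negP => fy.
have /connected_intervalP fCI : connected (f @` C).
  by apply: connected_continuous_connected => //; apply: continuous_subspaceT.
have [z /CA Az fz] : (f @` C) 0.
  apply: (fCI (f y) (f x)); [by exists y|by exists x|].
  by rewrite fy ltW.
by move: (f0 z Az); rewrite fz eqxx.
Qed.

Lemma segment_component (R : realType) (V : normedModType R) (A : set V)
    (x y : V) :
  (forall t : R, 0 <= t <= 1 -> A (x + t *: (y - x))) ->
  connected_component A x y.
Proof.
move=> xyA.
pose g (t : R) := x + t *: (y - x).
exists (g @` `[0, 1]); last first.
  by exists 1; rewrite /g /= ?in_itv/= ?ler01 ?lexx// scale1r addrC subrK.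
split.
- by exists 0; rewrite /g /= ?in_itv/= ?ler01 ?lexx// scale0r addr0.
- by move=> _ [t /= + <-]; rewrite in_itv => /xyA.
- apply: connected_continuous_connected; first exact: segment_connected.
  apply: continuous_subspaceT => t.
  by apply: cvgD; [exact: cvg_cst|apply: cvgZr_tmp; exact: cvg_id].
Qed.

Local Notation coord0 := Defs.coord0.

Section Arrangement.
Context (R : realType) (n m d l : nat) (d_gt0 : (0 < d)%N).
Implicit Types (Theta : 'I_l.+1 -> set int) (a b : 'I_l.+1 -> int)
  (x y : 'rV[R]_l).

Definition real_config a : 'rV[R]_l := \row_i (a (lift ord0 i))%:~R.

Lemma coord0_real_config a k : a ord0 = 0 ->
  coord0 (real_config a) k = (a k)%:~R.
Proof.
move=> a0; rewrite /coord0; case: unliftP => [i|] ->; first by rewrite mxE.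
by rewrite a0.
Qed.

Lemma coord0_continuous k : continuous (fun x => coord0 x k).
Proof.
rewrite /coord0; case: (unlift ord0 k) => [i|]; last exact: cst_continuous.
exact: coord_continuous.
Qed.

Lemma coord0_segment x y (t : R) k :
  coord0 (x + t *: (y - x)) k = coord0 x k + t * (coord0 y k - coord0 x k).
Proof.
rewrite /coord0; case: (unlift ord0 k) => [i|]; first by rewrite !mxE.
by rewrite subr0 mulr0 addr0.
Qed.

Lemma coord0_ge0 x k : orthant x -> 0 <= coord0 x k.
Proof. by move=> x0; rewrite /coord0; case: (unlift ord0 k). Qed.

Lemma segment_ge0 (t u v : R) : 0 <= t -> t <= 1 -> 0 <= u -> 0 <= v ->
  0 <= u + t * (v - u).
Proof. by move=> t0 t1 u0 v0; nra. Qed.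

Lemma segment_gt0 (t u v : R) : 0 <= t -> t <= 1 -> 0 < u -> 0 < v ->
  0 < u + t * (v - u).
Proof.
move=> t0 t1 u0 v0; have [uv|vu] := leP u v; first by nra.
by apply: lt_le_trans v0 _; nra.
Qed.

Lemma dilate_intr (s : int) (c : int) :
  d%:R * s%:~R + c%:~R = (d%:Z * s + c)%:~R :> R.
Proof. by rewrite intrD intrM. Qed.

(** Each comparison between skeleton points is the sign of an affine function
    that does not vanish off the arrangement, and these signs cut out a convex
    set. *)
Lemma component_same_order Theta a b x y : config d a -> config d b ->
  orthant x -> orthant y ->
  (forall k, coord0 x k = (a k)%:~R) -> (forall k, coord0 y k = (b k)%:~R) ->
  connected_component (@orthant R l `\` Sigma m n d Theta) x y <->
  same_order n m d Theta a b.
Proof.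
move=> [a0 age da] [b0 bge db] x0 y0 xa yb.
split=> [xy i j s t ij Si Sj ltij|ab].
- pose f (z : 'rV[R]_l) : R :=
    (d%:R * t%:~R + coord0 z j) - (d%:R * s%:~R + coord0 z i).
  suff : 0 < f y by rewrite /f !yb subr_gt0 !dilate_intr ltr_int.
  have f_cont : continuous f.
    have g_cont (c : R) k : continuous (fun z : 'rV[R]_l => c + coord0 z k).
      move=> z; apply: (@cvgD _ _ _ (nbhs z) _ (cst c)).
        exact: cvg_cst.
      exact: coord0_continuous.
    move=> z.
    by apply: (@cvgB _ _ _ (nbhs z) _ _ _ _ _ (g_cont _ j z) (g_cont _ i z)).
  apply: (component_sign f_cont) xy _.
    move=> z [z0 zS]; apply/eqP => /eqP; rewrite subr_eq0 => /eqP E.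
    apply: zS; split=> //; exists i, j; split=> //.
    exists (d%:R * s%:~R + coord0 z i); split; first by exists s.
    by rewrite -E; exists t.
  by rewrite /f !xa subr_gt0 !dilate_intr ltr_int.
- apply: segment_component => t /andP[t0 t1].
  have zE k := coord0_segment x y t k.
  set z := x + _ in zE *; split.
    move=> i; have := zE (lift ord0 i); rewrite {1 2 3 4}/coord0 liftK => ->.
    exact: segment_ge0.
  have no i j s u : i != j -> skeleton n m (Theta i) s ->
      skeleton n m (Theta j) u -> d%:Z * s + a i < d%:Z * u + a j ->
      d%:R * s%:~R + coord0 z i <> d%:R * u%:~R + coord0 z j.
    move=> ij Si Sj lta; have ltb := ab _ _ _ _ ij Si Sj lta.
    rewrite !zE !xa !yb.
    move: lta ltb; rewrite -!(ltr_int R) -!dilate_intr -subr_gt0.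
    move=> lta; rewrite -subr_gt0 => /(segment_gt0 t0 t1 lta) + E.
    by rewrite (_ : _ + _ = 0) ?ltxx //; move: E; lra.
  move=> [_ [i [j [ij [v [[s Ss sv] [u Su uv]]]]]]].
  have : d%:Z * s + a i != d%:Z * u + a j.
    apply: contra ij => /eqP E; apply/eqP/da/eqP; rewrite eqz_mod_dvd.
    by rewrite (_ : _ - _ = (u - s) * d%:Z) ?dvdz_mull //; lia.
  rewrite neq_lt => /orP[lt|lt].
    by apply: (no _ _ _ _ ij Ss Su lt); rewrite sv uv.
  rewrite eq_sym in ij.
  by apply: (no _ _ _ _ ij Su Ss lt); rewrite sv uv.
Qed.

Lemma written_as_config D Theta x :
  written_as d D Theta x <->
  exists a, [/\ config d a, forall k, coord0 x k = (a k)%:~R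
              & D = assemble d Theta a].
Proof.
have DeltaE a : (forall k, coord0 x k = (a k)%:~R) ->
    Delta d Theta x = [set z%:~R | z in assemble d Theta a].
  move=> xa; apply/seteqP; split=> v.
    move=> [k _ [s Ts <-]]; exists (d%:Z * s + a k); first by exists k, s.
    by rewrite xa dilate_intr.
  move=> [z [k [s [Ts ->]]] <-]; exists k => //; exists s => //.
  by rewrite xa dilate_intr.
split=> [[x0 [a [xa da]] DD]|[a [[a0 age da] xa ->]]].
- exists a; split=> //.
    split=> //.
      by apply/eqP; rewrite -(eqr_int R) -xa /coord0 unlift_none.
    by move=> i; rewrite -(ler_int R) -xa; exact: coord0_ge0.
  rewrite (DeltaE a xa) in DD; apply/seteqP; split=> z Dz.
    have : [set z%:~R | z in D] (z%:~R : R) by exists z.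
    by rewrite DD => -[z' Dz' /eqP]; rewrite eqr_int => /eqP <-.
  have : [set z%:~R | z in assemble d Theta a] (z%:~R : R) by exists z.
  by rewrite -DD => -[z' Dz' /eqP]; rewrite eqr_int => /eqP <-.
- split; last by rewrite -DeltaE.
    move=> i; have := xa (lift ord0 i).
    by rewrite /coord0 liftK => ->; rewrite ler0z.
  by exists a.
Qed.

(** From here on the real arrangement is replaced by comparisons of integers. *)
Lemma equivalent_same_order D E : equivalent R m n d l D E <->
  exists Theta a b, [/\ invariant_family n m Theta,
    config d a /\ D = assemble d Theta a,
    config d b /\ E = assemble d Theta b & same_order n m d Theta a b].
Proof.
split; last first.
- case=> Theta [a [b [fT [ca ->] [cb ->] ab]]].
  have xa k : coord0 (real_config a) k = (a k)%:~R.
    by apply: coord0_real_config; case: ca.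
  have yb k : coord0 (real_config b) k = (b k)%:~R.
    by apply: coord0_real_config; case: cb.
  have wx : written_as d (assemble d Theta a) Theta (real_config a).
    by apply/written_as_config; exists a.
  have wy : written_as d (assemble d Theta b) Theta (real_config b).
    by apply/written_as_config; exists b.
  exists Theta; split=> //; exists (real_config a), (real_config b); split=> //.
  case: wx wy => x0 _ _ [y0 _ _].
  by apply/(component_same_order Theta ca cb x0 y0 xa yb).
- case=> Theta [fT [x [y [wx wy xy]]]].
  have [a [ca xa DE]] := (written_as_config _ _ _).1 wx.
  have [b [cb yb EE]] := (written_as_config _ _ _).1 wy.
  exists Theta, a, b; split=> //.
  case: wx wy => x0 _ _ [y0 _ _].
  by apply/(component_same_order Theta ca cb x0 y0 xa yb).
Qed.

End Arrangement.

(** * Admissible representatives *)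

Theorem theorem4p10 (R : realType) (m n d l : nat)
    (m_ge1 : (1 <= m)%N) (n_ge1 : (1 <= n)%N) (d_ge1 : (1 <= d)%N)
    (gcd_mn : gcdn m n = 1%N) (l_le : (l <= d - 1)%N)
    (C : set (set int)) (hC : equivalence_class R m n d l C) :
  exists! D : set int, C D /\ admissible m n d l D.
Proof.
have nm : coprime n m by rewrite /coprime gcdnC gcd_mn.
have ld : (l < d)%N by lia.
have nm_gt0 : (0 < n + m)%N by rewrite addn_gt0 n_ge1.
have [D ND ->] := hC.
case: (normalized_assemble d_ge1 ND) => Theta [a [fT ca DE]].
have [b [cb ab bb]] :=
  admissible_config_exists d_ge1 fT nm_gt0 ca.
exists (assemble d Theta b); split.
  split; last exact: assemble_admissible.
  split; first exact: assemble_normalized.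
  by apply/(equivalent_same_order R n m l d_ge1); exists Theta, a, b.
move=> F [[_ /(equivalent_same_order R n m l d_ge1)]].
case=> Theta' [a' [b' [fT' [ca' DE'] [cb' ->] ab']]] adm'.
(* Relabel the second writing of [D] so that it becomes the first. *)
have /choice[p pP] := assemble_inj d_ge1 fT fT' ca ca' (etrans (esym DE) DE').
have [a0 _ da] := ca; have [a0' _ da'] := ca'; have [b0' bge' db'] := cb'.
have p_inj : injective p.
  by move=> i j pij; apply: da; rewrite -(pP i).1 -(pP j).1 pij.
have p0 : p ord0 = ord0 by apply: da'; rewrite (pP _).1 a0 a0'.
have p_bij : bijective p := injF_bij p_inj.
have TE : Theta = Theta' \o p by apply/funext => k; rewrite /= (pP k).2.
have E : assemble d Theta (b' \o p) = assemble d Theta' b'.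
  by rewrite TE assemble_bij.
have cbp : config d (b' \o p).
  by split=> [|i|i j /db'/p_inj //] /=; rewrite ?p0.
have abp : same_order n m d Theta a (b' \o p).
  move=> i j s t ij; rewrite -(pP i).2 -(pP j).2 -(pP i).1 -(pP j).1.
  by apply: ab'; rewrite (inj_eq p_inj).
rewrite -E; congr assemble.
apply: (admissible_config_unique d_ge1 fT n_ge1 nm cb cbp bb).
  by apply: admissible_assemble => //; rewrite E.
exact: same_order_trans (same_order_sym da ab) abp.
Qed.
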